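(* Let $X$ be a compact space and let $a,b\in X$. If $a$ and $b$ are pin equivalent in $X$, then $a$ and $b$ are Tukey equivalent, that is, the neighborhood filters $\mathcal{N}_X(a)$ and $\mathcal{N}_X(b)$, ordered by containment, are Tukey equivalent directed sets.
   Context: All spaces are assumed to be Hausdorff. Points $a,b$ in a compact space $X$ are pin equivalent (in $X$) if there exist a compact space $Y$, a continuous surjection $f\colon Y\to X$, and a homeomorphism $g\colon Y\to Y$ such that $g(f^{-1}\{a\})=f^{-1}\{b\}$. A directed set is a nonempty set equipped with a transitive reflexive relation $\leq$ such that every two elements have a common upper bound. For directed sets $P,Q$, $P$ is Tukey below $Q$ if there exists a map $f\colon Q\to P$ that is convergent, i.e., for every $p_0\in P$ there exists $q_0\in Q$ such that $f(q)\geq p_0$ for all $q\geq q_0$. $P$ and $Q$ are Tukey equivalent if each is Tukey below the other. $\mathcal{N}_X(a)$ denotes the set of all $N\subset X$ with $a$ in the interior of $N$; it is a directed set when ordered by containment ($\supset$), i.e., $N\leq M$ iff $N\supset M$. *)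

(* Defs.v *)
From HB Require Import structures.
From mathcomp Require Import all_boot all_order.
From mathcomp Require Import boolp classical_sets functions filter topology.

Set Implicit Arguments.
Unset Strict Implicit.
Unset Printing Implicit Defensive.

Local Open Scope classical_set_scope.

Definition compact_hausdorff (X : topologicalType) : Prop :=
  compact [set: X] /\ hausdorff_space X.

Definition homeomorphism (X Y : topologicalType) (g : X -> Y) : Prop :=
  exists h : Y -> X,
    [/\ cancel g h, cancel h g, continuous g & continuous h].

Definition pin_equivalent (X : topologicalType) (a b : X) : Prop :=
  exists (Y : topologicalType) (f : Y -> X) (g : Y -> Y),
    [/\ compact_hausdorff Y,
        continuous f /\ set_surj [set: Y] [set: X] f,
        homeomorphism g
      & g @` (f @^-1` [set a]) = f @^-1` [set b]].

Record directed_set := DirectedSet {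
  dcarrier :> Type;
  dle : dcarrier -> dcarrier -> Prop;
  dinhabited : inhabited dcarrier;
  dle_refl : forall x, dle x x;
  dle_trans : forall x y z, dle x y -> dle y z -> dle x z;
  dle_directed : forall x y, exists z, dle x z /\ dle y z
}.

Definition convergent (P Q : directed_set) (f : Q -> P) : Prop :=
  forall p0 : P, exists q0 : Q, forall q : Q, dle q0 q -> dle p0 (f q).

Definition tukey_below (P Q : directed_set) : Prop :=
  exists f : Q -> P, convergent f.

Definition tukey_equivalent (P Q : directed_set) : Prop :=
  tukey_below P Q /\ tukey_below Q P.

Section NeighborhoodFilter.
Variables (X : topologicalType) (a : X).

Definition neighborhood : Type := {N : set X | interior N a}.

Definition neighborhood_le (N M : neighborhood) : Prop :=
  sval M `<=` sval N.

Lemma neighborhood_inhabited : inhabited neighborhood.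
Proof. by constructor; exists setT; exact: filterT. Qed.

Lemma neighborhood_le_refl (N : neighborhood) : neighborhood_le N N.
Proof. by []. Qed.

Lemma neighborhood_le_trans (N M K : neighborhood) :
  neighborhood_le N M -> neighborhood_le M K -> neighborhood_le N K.
Proof. by move=> NM MK x /MK /NM. Qed.

Lemma neighborhood_le_directed (N M : neighborhood) :
  exists K, neighborhood_le N K /\ neighborhood_le M K.
Proof.
case: N M => [N aN] [M aM].
have aNM : interior (N `&` M) a by exact: filterI.
by exists (exist _ (N `&` M) aNM); split => x [].
Qed.

Definition neighborhood_filter : directed_set :=
  DirectedSet neighborhood_inhabited neighborhood_le_refl
    neighborhood_le_trans neighborhood_le_directed.

End NeighborhoodFilter.

(* Main.v *)
(* Pull a neighborhood [N] of [b] back along [f] and [g], then push it forward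
   along [f]: the set [f (g^-1 (f^-1 N))] is a neighborhood of [a], and it shrinks
   to [a] as [N] shrinks to [b].  Both facts hold because [f] is a closed map, so
   that the neighborhoods of a fiber [f^-1 x] are exactly the supersets of
   preimages of neighborhoods of [x]. *)
Require Import Defs.
From HB Require Import structures.
From mathcomp Require Import all_boot all_order.
From mathcomp Require Import boolp classical_sets functions filter topology.

Local Open Scope classical_set_scope.

(** The complement of [interior W] is closed in [Y], hence compact, so its image is closed in [X].
    This image misses [x], and any fiber over a point outside it lies in [W]. *)
Lemma tube_lemma (X Y : topologicalType) (f : Y -> X) (x : X) (W : set Y) :
  compact [set: Y] -> hausdorff_space X -> continuous f ->
  f @^-1` [set x] `<=` interior W -> nbhs x [set z | f @^-1` [set z] `<=` W].
Proof.
move=> cptY hausX ctsf fxW.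
have closed_im : closed (f @` ~` interior W).
  apply: compact_closed => //; apply: continuous_compact.
    exact: continuous_subspaceT.
  apply: (subclosed_compact _ cptY) => //.
  exact/open_closedC/open_interior.
have : nbhs x (~` (f @` ~` interior W)).
  apply: open_nbhs_nbhs; split; first exact: closed_openC.
  by case=> y yW fyx; apply: yW; exact: fxW.
apply: filterS => z zW y fyz; apply: interior_subset.
by apply: contrapT => yW; apply: zW; exists y.
Qed.

Lemma pin_equivalent_sym (X : topologicalType) (a b : X) :
  pin_equivalent a b -> pin_equivalent b a.
Proof.
move=> [Y [f [g [cY cf [h [gK hK cg ch]] gab]]]].
exists Y, f, h; split=> //; first by exists g.
rewrite -gab -[RHS]image_id image_comp; apply: eq_imagel => y _; exact: gK.
Qed.

Lemma pin_equivalent_tukey_below (X : topologicalType) (a b : X) :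
  hausdorff_space X -> pin_equivalent a b ->
  tukey_below (neighborhood_filter a) (neighborhood_filter b).
Proof.
move=> hausX [Y [f [g [[cptY _] [ctsf surjf] [h [gK hK ctsg ctsh]] gab]]]].
have nbhs_a (N : neighborhood b) : interior (f @` (g @^-1` (f @^-1` sval N))) a.
  case: N => N /= bN.
  have : nbhs a [set z | f @^-1` [set z] `<=` g @^-1` (f @^-1` N)].
    apply: tube_lemma => // y fya; apply: ctsg; apply: ctsf.
    have -> : f (g y) = b by rewrite -[_ = b]/((f @^-1` [set b]) (g y)) -gab; exists y.
    exact: bN.
  apply: filterS => z zN.
  (* Surjectivity makes the fiber over [z] nonempty, which puts [z] in the image. *)
  by have [y _ fyz] := surjf z I; exists y => //; exact: zN.
exists (fun N => exist (fun A => interior A a) _ (nbhs_a N)) => -[M aM].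
(* The convergence witness for [M]: the points whose whole fiber [h] sends into [f^-1 M]. *)
have nbhs_b : interior [set z | f @^-1` [set z] `<=` h @^-1` (f @^-1` M)] b.
  apply: tube_lemma => // y.
  rewrite -gab => -[w fwa <-]; apply: ctsh; apply: ctsf.
  by rewrite gK fwa; exact: aM.
(* If [f (g y)] lies in [N], then [g y] is in a fiber that [h] sends into [f^-1 M], so [y = h (g y)]
   has [f y] in [M]. *)
exists (exist (fun A => interior A b) _ nbhs_b) => -[N bN] NN0 _ /= [y Ny <-].
by rewrite -[y]gK; exact: (NN0 _ Ny).
Qed.

Theorem theorem3p5 (X : topologicalType) (a b : X) :
  compact_hausdorff X ->
  pin_equivalent a b ->
  tukey_equivalent (neighborhood_filter a) (neighborhood_filter b).
Proof.
move=> [_ hausX] pin_ab; split; apply: pin_equivalent_tukey_below => //.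
exact: pin_equivalent_sym.
Qed.
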